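(* Let $E$ be a nonempty finite union of intervals in $\mathbb{R}$. Then a translate of $E$ can be reconstructed using $1$ set; that is, there exists a measurable set $T\subset\mathbb{R}$ such that $\lambda((E+t)\cap T)\neq\lambda((E+t')\cap T)$ whenever $t,t'\in\mathbb{R}$ and $t\neq t'$.
   Context: $\lambda$ denotes Lebesgue measure on $\mathbb{R}$. By interval we always mean a bounded nondegenerate closed interval. *)

(* Defs.v *)
From HB Require Import structures.
From mathcomp Require Import all_boot all_order all_algebra.
From mathcomp Require Import all_classical all_reals all_analysis.

Set Implicit Arguments.
Unset Strict Implicit.
Unset Printing Implicit Defensive.

Import Order.TTheory GRing.Theory Num.Theory.
Import numFieldNormedType.Exports.

Local Open Scope classical_set_scope.
Local Open Scope ring_scope.

Definition nondeg_segment (R : realType) (I : set R) : Prop :=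
  exists a b : R, a < b /\ I = `[a, b]%classic.

Definition finite_union_of_intervals (R : realType) (E : set R) : Prop :=
  exists F : set (set R),
    [/\ finite_set F, F `<=` @nondeg_segment R & E = \bigcup_(I in F) I].

Definition translate (R : realType) (E : set R) (t : R) : set R :=
  [set x + t | x in E].

(* The domain of [completed_lebesgue_measure]: Caratheodory's sigma-algebra for
   the Lebesgue outer measure, which [completed_caratheodory_measurable]
   identifies with the completion of the Borel sigma-algebra. *)
Definition lebesgue_measurable (R : realType) : set (set R) :=
  (@wlength R idfun)^*%mu.-cara.-measurable.

(* Main.v *)
Require Import Defs.
From mathcomp Require Import all_boot all_order all_algebra.
From mathcomp Require Import all_classical all_reals all_analysis measurable_realfun.
From mathcomp Require Import lra.

Set Implicit Arguments.
Unset Strict Implicit.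
Unset Printing Implicit Defensive.

Import Order.TTheory GRing.Theory Num.Theory.

Local Open Scope classical_set_scope.
Local Open Scope ring_scope.

(** Write E as a disjoint union of segments [a_i, b_i], with lengths l_i.  A
translate of E is reconstructed by any T for which t |-> mu ((E + t) `&` T) is
strictly increasing, and this function is the sum over i of the mass of T in
the window [a_i + t, b_i + t].

When such a window moves from t to t' > t, the change of mass is the mass of T
in ]b_i + t, b_i + t'] minus the mass of T in ]a_i + t, a_i + t'], and the
second interval shifted by l_i is the first one.  So if T is stable under
adding l_i, no mass is lost ([window_le]).  Mass is really gained if every
interval contains a non-negligible set of points of T that do not come from a
point of T by adding l_i ([window_lt]).  It is enough to have this for one of
the lengths, say l.

Let S be the additive monoid generated by the lengths, and T := Y + S.  This is
stable under adding each length, and a point y of Y is not in T + l as soon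
as no difference of two points of Y lies in l + S ([increasing_test_set]).  What
remains is to find a Borel set Y that has positive measure in every interval
and whose difference set avoids l + S ([sparse_set]).

This is possible because the lengths are positive, so that l + S is locally
finite even when it generates a dense group.  Take countably many tiny intervals
I_k, one inside each member of a basis of the line, and remove from I_k all the
translates of the later I_j, j > k, by those elements of l + S and of its
opposite that could bring I_j onto I_k.  For each j there are finitely many such
elements, and their number is known before the length of I_j is chosen, so this
length can be taken so small that at least half of I_k remains. *)

(** * Translations and Lebesgue measure *)

Section lebesgue_translation.
Context {R : realType}.
Implicit Types (A : set R) (t : R).
Local Notation mu := (@lebesgue_measure R).

Lemma translateE A t : translate A t = (fun x => x - t) @^-1` A.
Proof.
apply/seteqP; split => [_ [x Ax <-]|x Ax] /=; first by rewrite addrK.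
by exists (x - t) => //; rewrite subrK.
Qed.

Lemma translate_itv_oc (a b t : R) : translate `]a, b] t = `]a + t, b + t]%classic.
Proof.
rewrite translateE; apply/seteqP; split => x /=; rewrite !in_itv/=;
  by rewrite ltrBrDr lerBlDr.
Qed.

Lemma measurable_translate A t : measurable A -> measurable (translate A t).
Proof.
move=> mA; rewrite translateE -[X in measurable X]setTI.
have : measurable_fun [set: R] (fun x => x - t) by apply: measurable_funB.
by apply.
Qed.

Lemma lebesgue_measure_translate A t : measurable A -> mu (translate A t) = mu A.
Proof.
move=> mA; rewrite translateE.
rewrite -[LHS]/(pushforward mu (fun x : R => x - t : measurableTypeR R) A).
apply/esym/lebesgue_measure_unique => //=; first exact: measurable_funB.
move=> _ _ [[a b]] _ <-.
rewrite /pushforward -[X in _ = lebesgue_measure X](translateE `]a, b]).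
rewrite translate_itv_oc !lebesgue_measure_itv/= !lte_fin ltrD2r.
by rewrite -!EFinB; congr (if _ then _%:E else _); lra.
Qed.

End lebesgue_translation.

(** * The mass of a test set seen through a sliding window *)

Section sliding_window.
Context {R : realType}.
Local Notation mu := (@lebesgue_measure R).
Variable T : set R.
Hypothesis mT : measurable T.

Let mass a b := mu (T `&` `]a, b]).

Lemma mass_itv_split (a c b : R) : a <= c -> c <= b ->
  (mass a b = mass a c + mass c b)%E.
Proof.
move=> ac cb; rewrite /mass -measureU; first last.
- rewrite -subset0 => x [[_]]/=; rewrite !in_itv/= => /andP[_ xc] [_].
  by rewrite ltNge xc.
- exact: measurableI.
- exact: measurableI.
congr mu; rewrite -setIUr; congr (_ `&` _).
apply/seteqP; split => x /=; rewrite !in_itv/=.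
  by case: (leP x c) => [xc|cx] /andP[ax xb]; [left|right]; rewrite ?ax ?cx.
by move=> [/andP[-> xc]|/andP[cx ->]]; rewrite ?(le_trans xc)// (le_lt_trans ac).
Qed.

Lemma mass_itv_fin (a b : R) : mass a b \is a fin_num.
Proof.
have m1 : measurable (`]a, b] : set R) by [].
rewrite ge0_fin_numE//; apply: (le_lt_trans (measureIr mu mT m1)).
by rewrite /= lebesgue_measure_itv/=; case: ifP => // _; rewrite ltry.
Qed.

Let window a b t := mu (translate `[a, b] t `&` T).

Lemma windowE (a b t : R) : a <= b -> window a b t = mass (a + t) (b + t).
Proof.
move=> ab; rewrite /window /mass.
have -> : translate `[a, b] t = (a + t) |` `]a + t, b + t].
  rewrite setU1itv ?bnd_simp ?lerD2r// translateE.
  by apply/seteqP; split => x /=; rewrite !in_itv/= lerBrDr lerBlDr.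
rewrite setIUl measureU/=; first last.
- rewrite -subset0 => x [[/= -> _]] [].
  by rewrite in_itv/= ltxx.
- by apply: measurableI.
- by apply: measurableI.
rewrite (setIC _ T) [X in (X + _)%E](_ : _ = 0%E) ?add0e ?(setIC T)//.
by apply: (subset_measure0 _ _ _ (lebesgue_measure_set1 (a + t))) => //; apply: measurableI.
Qed.

Lemma window_fin (a b t : R) : a <= b -> window a b t \is a fin_num.
Proof. by move=> ab; rewrite windowE// mass_itv_fin. Qed.

(** Both sides are the mass of ]a + t, b + t'].  Comparing gain and loss
through this sum covers at once the positions of the window that overlap and
those that are disjoint. *)
Lemma window_balance (a b t t' : R) : a <= b -> t <= t' ->
  (window a b t + mass (b + t)%R (b + t')%R =
   mass (a + t)%R (a + t')%R + window a b t')%E.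
Proof.
by move=> ab tt'; rewrite !windowE// -!mass_itv_split//; lra.
Qed.

Variable l : R.
Hypothesis Tl : forall x, T x -> T (x + l).

Lemma mass_translate (a b : R) :
   mu (translate (T `&` `]a, b]) l) = mass a b.
Proof. by rewrite lebesgue_measure_translate//; exact: measurableI. Qed.

Lemma mass_shift_le (a b : R) : (mass a b <= mass (a + l)%R (b + l)%R)%E.
Proof.
rewrite -mass_translate; apply: le_measure; rewrite ?inE.
- by apply: measurable_translate; exact: measurableI.
- exact: measurableI.
move=> _ [x [Tx xab] <-]; split; first exact: Tl.
by move: xab; rewrite /= !in_itv/= ltrD2r lerD2r.
Qed.

(** The mass lost in ]a + t, a + t'] is found again, shifted by the length l of
the window, in the interval ]a + l + t, a + l + t'] that comes into view. *)
Lemma window_le (a t t' : R) : 0 <= l -> t <= t' ->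
  (window a (a + l)%R t <= window a (a + l)%R t')%E.
Proof.
move=> l0 tt'; have ab : a <= a + l by lra.
have := window_balance ab tt'.
have := mass_shift_le (a + t) (a + t').
rewrite (addrAC a t l) (addrAC a t' l) => m E.
rewrite -(leeD2rE _ _ (mass_itv_fin (a + l + t) (a + l + t'))).
by rewrite E addeC leeD2l.
Qed.

(** Y consists of points of T that adding l to points of T does not produce, and
it is everywhere non-negligible: it makes the comparison strict. *)
Variable Y : set R.
Hypothesis mY : measurable Y.
Hypothesis YT : Y `<=` T.
Hypothesis YlT : forall y, Y y -> ~ T (y - l).
Hypothesis Ypos : forall u v : R, u < v -> (0 < mu (Y `&` `]u, v]))%E.

Lemma mass_shift_lt (a b : R) : a < b -> (mass a b < mass (a + l)%R (b + l)%R)%E.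
Proof.
move=> ab; have ab' : a + l < b + l by lra.
have m1 : measurable (translate (T `&` `]a, b]) l).
  by apply: measurable_translate; exact: measurableI.
have m2 : measurable (Y `&` `]a + l, b + l]) by exact: measurableI.
apply: (@lt_le_trans _ _ (mu (translate (T `&` `]a, b]) l `|` Y `&` `]a + l, b + l]))).
  rewrite measureU//=; first by rewrite mass_translate lteDl ?mass_itv_fin ?Ypos.
  rewrite -subset0 => _ [[x [Tx _] <-] [Yx _]].
  by apply: (YlT Yx); rewrite addrK.
apply: le_measure; rewrite ?inE; [exact: measurableU|exact: measurableI|].
move=> x [[y [Ty yab] <-]|[Yx xab]]; split => //; [exact: Tl| |exact: YT].
by move: yab; rewrite /= !in_itv/= ltrD2r lerD2r.
Qed.

Lemma window_lt (a t t' : R) : 0 <= l -> t < t' ->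
  (window a (a + l)%R t < window a (a + l)%R t')%E.
Proof.
move=> l0 tt'; have ab : a <= a + l by lra.
have att' : a + t < a + t' by lra.
have := window_balance ab (ltW tt').
have := mass_shift_lt att'.
rewrite (addrAC a t l) (addrAC a t' l) => m E.
rewrite -(lteD2rE _ _ (mass_itv_fin (a + l + t) (a + l + t'))).
by rewrite E addeC lteD2lE ?window_fin.
Qed.

End sliding_window.

(** * Finite unions of segments as disjoint unions *)

Section disjoint_segments.
Context {R : realType}.
Implicit Type s : seq (R * R).

Fixpoint segments s : set R :=
  if s is p :: s' then `[p.1, p.2] `|` segments s' else set0.

Fixpoint separated s : Prop :=
  if s is p :: s' then
    [/\ p.1 < p.2, `[p.1, p.2] `&` segments s' = set0 & separated s']
  else True.

Lemma measurable_segments s : measurable (segments s).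
Proof. by elim: s => [|p s ih] //=; exact: measurableU. Qed.

Lemma setU_itvcc (a b c d x : R) : a <= x <= b -> c <= x <= d ->
  `[a, b] `|` `[c, d] = `[Num.min a c, Num.max b d]%classic.
Proof.
move=> /andP[ax xb] /andP[cx xd]; apply/seteqP; split => y /=; rewrite !in_itv/=.
  by move=> [] /andP[? ?]; rewrite ge_min le_max; apply/andP; split;
    apply/orP; (by left) || (by right).
rewrite ge_min le_max => /andP[/orP ay /orP yb].
case: (leP y x) => [yx|/ltW xy].
  by case: ay => ?; [left|right]; apply/andP; split => //; apply: le_trans yx _.
by case: yb => ?; [left|right]; apply/andP; split => //; apply: le_trans xy.
Qed.

(** A segment that meets a member of the family is merged with it, and the
larger segment is inserted in the rest of the family.  It may meet further
members, hence the induction with a and b generalized. *)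
Lemma separated_insert (a b : R) s : a < b -> separated s ->
  exists2 s', separated s' & segments s' = `[a, b] `|` segments s.
Proof.
elim: s a b => [|[c d] s ih] a b ab /=.
  by exists [:: (a, b)]; split => //=; rewrite setI0.
move=> [/= cd cds ss].
have [ae|/set0P[x [/= xab xcd]]] := eqVneq (`[a, b] `&` `[c, d]) set0.
  have [s' ss' E] := ih a b ab ss.
  exists ((c, d) :: s') => /=; last by rewrite E setUCA.
  split => //=.
  by rewrite E setIUr cds setU0 setIC.
move: xab xcd; rewrite !in_itv/= => xab xcd.
have mM : Num.min a c < Num.max b d by rewrite gt_min lt_max ab.
have [s' ss' E] := ih _ _ mM ss.
by exists s' => //; rewrite E setUA (setU_itvcc xab xcd).
Qed.

Lemma finite_union_separated (E : set R) : finite_union_of_intervals E ->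
  exists2 s, separated s & segments s = E.
Proof.
move=> [F [/finite_seqP[r ->] Fseg ->]].
elim: r Fseg => [|I r ih] Fseg.
  by exists [::] => //=; rewrite set_nil bigcup_set0.
have [|s ss Es] := ih; first by move=> J Jr; apply: Fseg; rewrite /= in_cons Jr orbT.
have [|a [b [ab Iab]]] := Fseg I; first by rewrite /= mem_head.
have [s' ss' Es'] := separated_insert ab ss.
by exists s' => //; rewrite Es' Es !bigcup_seq big_cons Iab.
Qed.

End disjoint_segments.

(** * The monoid generated by the lengths is locally finite *)

Section sums_of_lengths.
Context {R : realType}.

Inductive sums_of (L : seq R) : set R :=
| sums_of0 : sums_of L 0
| sums_ofS x l : sums_of L x -> l \in L -> sums_of L (x + l).

(** The bound is one-sided because the notion serves for sets of nonnegative
numbers; on those it is local finiteness. *)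
Definition locally_finite (D : set R) :=
  forall M : R, exists s : seq R, forall d, D d -> d <= M -> d \in s.

Lemma locally_finite_shift (D : set R) (c : R) :
  locally_finite D -> locally_finite (translate D c).
Proof.
move=> lfD M; have [s sP] := lfD (M - c).
exists [seq d + c | d <- s] => _ [d Dd <-] dM.
by apply: map_f; apply: sP => //; lra.
Qed.

Lemma locally_finite_countable (D : set R) : locally_finite D -> countable D.
Proof.
move=> lfD; have [s sP] := boolp.choice (fun n : nat => lfD n%:R).
have : countable (\bigcup_n [set` s n]).
  by apply: bigcup_countable => // n _; exact/finite_set_countable/finite_seq.
apply: sub_countable; apply: subset_card_le => d Dd.
exists (Num.truncn d).+1 => //=; apply: sP => //.
by apply/ltW/truncnS_gt.
Qed.

Lemma pos_seq_lower_bound (L : seq R) : (forall l, l \in L -> 0 < l) ->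
  exists2 m, 0 < m & forall l, l \in L -> m <= l.
Proof.
elim: L => [|l L ih] L0; first by exists 1.
have [|m m0 mL] := ih; first by move=> k kL; rewrite L0// in_cons kL orbT.
exists (Num.min l m); first by rewrite lt_min m0 L0// mem_head.
move=> k; rewrite in_cons ge_min => /predU1P[->|/mL ->]; first by rewrite lexx.
by rewrite orbT.
Qed.

Variable L : seq R.
Hypothesis L0 : forall l, l \in L -> 0 < l.

Lemma sums_of_ge0 x : sums_of L x -> 0 <= x.
Proof. by elim=> // {}x l _ x0 /L0 l0; lra. Qed.

(** If every length is at least m > 0, an element of the monoid that is at most
n m has at most n terms, and there are finitely many such sums. *)
Lemma sums_of_locally_finite : locally_finite (sums_of L).
Proof.
have [m m0 mL] := pos_seq_lower_bound L0.
have H (n : nat) : exists s : seq R, forall x, sums_of L x -> x <= m * n%:R -> x \in s.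
  elim: n => [|n [s sP]].
    exists [:: 0] => x Lx; rewrite mulr0 => x0; rewrite inE; apply/eqP/le_anti.
    by rewrite x0 sums_of_ge0.
  exists (0 :: [seq y + l | y <- s, l <- L]) => x [|{}x l Lx lL xn].
    by rewrite mem_head.
  rewrite in_cons; apply/orP; right; apply/allpairsP; exists (x, l); split => //=.
  by apply: sP => //; have := mL _ lL; move: xn; rewrite -natr1 mulrDr; lra.
move=> M; have [s sP] := H (Num.truncn (M / m)).+1.
exists s => x Lx xM; apply: sP => //; apply: (le_trans xM).
by rewrite mulrC -ler_pdivrMr//; apply/ltW/truncnS_gt.
Qed.

End sums_of_lengths.

(** * An everywhere non-negligible set with a sparse difference set *)

Section sparse_set.
Context {R : realType}.
Local Notation mu := (@lebesgue_measure R).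

(** Intervals with a rational left end and a rational length, enumerated by
countability of the pairs of rationals; codes of no such pair are sent to the
interval of left end 0 and length 1. *)
Lemma interval_basis : exists c r : nat -> R,
  (forall k, 0 < r k) /\
  forall u v, u < v -> exists k, u <= c k /\ c k + r k <= v.
Proof.
pose f k : R * R := if unpickle k is Some (p, q) then
  if 0 < ratr q :> R then (ratr p, ratr q) else (0, 1) else (0, 1).
exists (fst \o f), (snd \o f); split => [k|u v uv] /=.
  by rewrite /f; case: (unpickle k : option (rat * rat)) => [[p q]|//]; case: ifP.
have [p] := rat_in_itvoo uv; rewrite in_itv/= => /andP[up pv].
have [q] : exists q : rat, ratr q \in `]0, v - ratr p[ by apply: rat_in_itvoo; lra.
rewrite in_itv/= => /andP[q0 qv].
exists (pickle (p, q)); rewrite /f pickleK q0 /=; lra.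
Qed.

(** Lengths bounded by r, such that N k intervals of the k-th length have a total
length which is small compared with all the previous lengths, in a summable way:
see [tinyD]. *)
Fixpoint tiny (r : nat -> R) (N : nat -> nat) k : R :=
  if k is j.+1 then Num.min (r k) (tiny r N j / 4 / (N k).+1%:R) else r 0%N.

Lemma tiny_gt0 r N k : (forall k, 0 < r k) -> 0 < tiny r N k.
Proof.
by move=> r0; elim: k => //= k ih; rewrite lt_min r0 !divr_gt0.
Qed.

Lemma tiny_le r N k : tiny r N k <= r k.
Proof. by case: k => //= k; rewrite ge_min lexx. Qed.

Lemma tinyS r N k : (forall k, 0 < r k) ->
  (N k.+1).+1%:R * tiny r N k.+1 <= tiny r N k / 4.
Proof.
move=> r0; rewrite mulrC -ler_pdivlMr//=.
by rewrite ge_min lexx orbT.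
Qed.

(** The bounds on the right add up to half of the k-th length when i ranges over
the naturals. *)
Lemma tinyD r N k i : (forall k, 0 < r k) ->
  (N (k + i).+1)%:R * tiny r N (k + i).+1 <= tiny r N k / 2 / (2 ^ i.+1)%:R.
Proof.
move=> r0; have half j : tiny r N j.+1 <= tiny r N j / 2.
  have := tinyS N j r0; have := tiny_gt0 N j.+1 r0; have := tiny_gt0 N j r0.
  rewrite -natr1 mulrDl mul1r; have := ler0n R (N j.+1); nra.
have geo : tiny r N (k + i) <= tiny r N k / (2 ^ i)%:R.
  elim: i => [|i ih]; first by rewrite addn0 expn0 divr1.
  rewrite addnS; apply: (le_trans (half _)).
  rewrite expnS natrM invfM mulrA (mulrAC _ 2^-1).
  by rewrite ler_pM2r ?invr_gt0.
have := tinyS N (k + i) r0; have := tiny_gt0 N (k + i).+1 r0.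
rewrite -natr1 expnS natrM invfM; lra.
Qed.

Let neighbours (w : seq R) (I : set R) := \big[setU/set0]_(d <- w) translate I d.

Lemma measurable_neighbours w I : measurable I -> measurable (neighbours w I).
Proof. by move=> mI; apply: bigsetU_measurable => d _; exact: measurable_translate. Qed.

Lemma measure_neighbours w I : measurable I ->
  (mu (neighbours w I) <= (size w)%:R%:E * mu I)%E.
Proof.
move=> mI; rewrite /neighbours; elim: w => [|d w ih].
  by rewrite big_nil measure0 mul0e.
rewrite big_cons; apply: le_trans (measureU2 _ _ _) _.
- exact: measurable_translate.
- exact: measurable_neighbours.
rewrite /= lebesgue_measure_translate//= -natr1 EFinD ge0_muleDl ?lee_fin//.
by rewrite mul1e addeC leeD2r.
Qed.

Lemma neighboursP w I d x : d \in w -> I (x - d) -> neighbours w I x.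
Proof.
by move=> dw Ixd; rewrite /neighbours -bigcup_seq; exists d => //; rewrite translateE.
Qed.

(** The pieces Y k of Y are tiny intervals I k from which the dangerous
translates of all later intervals I j are removed.  Since the removal at k
takes care of every pair (k, j) with k < j, in both orders, nothing has to be
removed from the later piece.  Pairs of points in the same piece are handled by
taking I k no longer than the lower bound l of D. *)
Lemma sparse_set (D : set R) (l : R) : 0 < l -> (forall d, D d -> l <= d) ->
  locally_finite D ->
  exists Y : set R, [/\ measurable Y,
    (forall u v, u < v -> (0 < mu (Y `&` `]u, v]))%E) &
    (forall x y, Y x -> Y y -> ~ D (x - y))].
Proof.
move=> l0 Dl lfD.
have [c [r [r0 cr]]] := interval_basis.
(* The intervals of index at most j lie in [- B j, B j], so the differences
   between two of their points are at most 2 * B j in absolute value. *)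
pose B j := \sum_(i < j.+1) (`|c i| + r i).
have [s sP] := boolp.choice (fun j => lfD (2 * B j)).
pose w j := s j ++ [seq - d | d <- s j].
pose r' k := Num.min (r k) l.
have r'0 k : 0 < r' k by rewrite lt_min r0 l0.
pose e := tiny r' (size \o w).
have e0 k : 0 < e k by exact: tiny_gt0.
have [er el] : (forall k, e k <= r k) /\ (forall k, e k <= l).
  by split => k; apply: (le_trans (tiny_le _ _ _)); rewrite ge_min lexx ?orbT.
pose I k := `]c k, c k + e k]%classic.
have mI k : measurable (I k) by exact: measurable_itv.
have muI k : mu (I k) = (e k)%:E.
  by rewrite lebesgue_measure_itv/= lte_fin ltrDl e0 -EFinB addrAC subrr add0r.
pose Z j := neighbours (w j) (I j).
have mZ j : measurable (Z j) by exact: measurable_neighbours.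
have mU k : measurable (\bigcup_i Z (k + i).+1).
  by apply: bigcupT_measurable => i; exact: mZ.
pose Y k := I k `\` \bigcup_i Z (k + i).+1.
have mY k : measurable (Y k).
  exact: measurableD.
(* The removed part of I k has at most half of its measure. *)
have Ypos k : (0 < mu (Y k))%E.
  have Ye : ((e k)%:E <= mu (Y k) + (e k / 2)%:E)%E.
    have tail : (mu (\bigcup_i Z (k + i).+1) <= (e k / 2)%:E)%E.
      apply: (le_trans (measure_sigma_subadditive mu (fun i => mZ (k + i).+1) (mU k)
        (@subset_refl _ _))).
      have e20 : 0 <= e k / 2 by rewrite divr_ge0 ?ltW.
      apply: le_trans (epsilon_trick0 xpredT e20).
      apply: lee_nneseries => [//|i _].
      apply: (le_trans (measure_neighbours _ (mI _))).
      by rewrite muI -EFinM lee_fin; exact: (tinyD (size \o w)).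
    apply: le_trans (leeD2l _ tail); rewrite -muI.
    apply: le_trans (measureU2 mu (mY k) (mU k)).
    apply: le_measure; rewrite ?inE; [exact: mI|exact: (measurableU _ _ (mY k) (mU k))|].
    by move=> x Ix; rewrite /Y; case: (pselect ((\bigcup_i Z (k + i).+1) x)); [right|left].
  rewrite lt0e measure_ge0 andbT; apply/eqP => Y0.
  by move: Ye; rewrite Y0 add0e lee_fin; have := e0 k; lra.
have Bk k j x : (k <= j)%N -> I k x -> `|x| <= B j.
  move=> kj; rewrite /I /= in_itv/= => /andP[cx xc].
  have kj1 : (k < j.+1)%N by [].
  rewrite /B (bigD1 (Ordinal kj1))//=.
  have : 0 <= \sum_(i < j.+1 | i != Ordinal kj1) (`|c i| + r i).
    by apply: sumr_ge0 => i _; apply: addr_ge0 => //; exact: ltW.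
  have := er k; have := r0 k.
  have := ler_norm (c k); have := ler_norm (- c k); rewrite normrN.
  by move=> *; rewrite ler_norml; apply/andP; split; lra.
(* If the difference of x in Y k and y in Y j were in D up to sign, x would be
   in one of the translates of I j that were removed from I k. *)
have far k j x y : (k < j)%N -> Y k x -> Y j y -> ~ D (x - y) /\ ~ D (y - x).
  move=> kj [Ix nZ] [Iy _].
  have xB := Bk _ _ _ (ltnW kj) Ix; have yB := Bk _ _ _ (leqnn j) Iy.
  have {nZ}nZ : ~ Z j x.
    by move=> Zx; apply: nZ; exists (j - k.+1)%N => //; rewrite -addSn subnKC.
  split => Dd; apply: nZ.
  - apply: (neighboursP (d := x - y)); last by rewrite opprB addrC subrK.
    rewrite mem_cat sP//; apply: le_trans (ler_norm _) _.
    by apply: le_trans (ler_normB _ _) _; lra.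
  - apply: (neighboursP (d := - (y - x))); last by rewrite opprK addrC subrK.
    rewrite mem_cat (map_f _ (sP j _ Dd _)) ?orbT//; apply: le_trans (ler_norm _) _.
    by apply: le_trans (ler_normB _ _) _; lra.
exists (\bigcup_k Y k); split.
- exact: bigcupT_measurable.
- move=> u v /cr[k [uc cv]]; apply: (lt_le_trans (Ypos k)).
  have mYuv : measurable ((\bigcup_k Y k) `&` `]u, v]).
    by apply: measurableI => //; exact: bigcupT_measurable.
  apply: le_measure; rewrite ?inE; [exact: mY|exact: mYuv|].
  move=> x Yx; split; first by exists k.
  case: Yx => + _; rewrite /I /= !in_itv/= => /andP[cx xc].
  by have := er k => ?; apply/andP; split; lra.
- move=> x y [k _ Yx] [j _ Yy].
  have [kj|jk|kj] := ltngtP k j.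
  + by have [] := far _ _ _ _ kj Yx Yy.
  + by have [] := far _ _ _ _ jk Yy Yx.
  + move/Dl; case: Yx => + _; case: Yy => + _; rewrite /I kj /= !in_itv/=.
    by move=> /andP[? ?] /andP[? ?]; have := el j; lra.
Qed.

End sparse_set.

(** * The test set *)

(** Both measures are restrictions of the same outer measure. *)
Lemma completed_lebesgue_measureE (R : realType) (A : set R) :
  completed_lebesgue_measure A = lebesgue_measure A.
Proof. by []. Qed.

Lemma borel_lebesgue_measurable (R : realType) (A : set R) :
  measurable A -> lebesgue_measurable A.
Proof. exact: sub_caratheodory. Qed.

(** T is Y + S, where S is the monoid generated by L, and Y is a set as in
[sparse_set] for D = l + S: if y - l = z + d with z in Y and d in S, then the
difference y - z is in D. *)
Lemma increasing_test_set (R : realType) (L : seq R) (l : R) :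
  (forall k, k \in L -> 0 < k) -> l \in L ->
  exists T Y : set R, [/\ measurable T,
    (forall k, k \in L -> forall x, T x -> T (x + k)),
    [/\ measurable Y, Y `<=` T & forall y, Y y -> ~ T (y - l)] &
    forall u v, u < v -> (0 < lebesgue_measure (Y `&` `]u, v]))%E].
Proof.
move=> L0 lL; have l0 := L0 l lL.
have lfL := sums_of_locally_finite L0.
have [|Y [mY Ypos YD]] := sparse_set l0 _ (locally_finite_shift l lfL).
  by move=> _ [d /(sums_of_ge0 L0) d0 <-]; lra.
exists (\bigcup_(d in sums_of L) translate Y d), Y; split => //.
- rewrite bigcup_set_type; apply: countable_bigcupT_measurable => [|d].
    by rewrite (eq_countable (card_setT _)); exact: locally_finite_countable.
  exact: measurable_translate.
- move=> k kL _ [d Ld [y Yy <-]]; exists (d + k); first exact: sums_ofS.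
  by exists y; rewrite // addrA.
- split => // [y Yy|y Yy [d Ld [z Yz zE]]].
    by exists 0; [exact: sums_of0|exists y; rewrite ?addr0].
  apply: (YD _ _ Yy Yz); exists d => //.
  by rewrite (_ : y = z + d + l) 1?addrAC; lra.
Qed.


(** * Finite disjoint unions of windows *)

Section sliding_segments.
Context {R : realType}.
Local Notation mu := (@lebesgue_measure R).
Variable T : set R.
Hypothesis mT : measurable T.
Implicit Type s : seq (R * R).

Let mass s t := mu (translate (segments s) t `&` T).

Lemma mass_segments_cons p s t : separated (p :: s) ->
  (mass (p :: s) t = mu (translate `[p.1, p.2] t `&` T) + mass s t)%E.
Proof.
have mS : measurable (segments s) by exact: measurable_segments.
move=> [_ ps _]; rewrite /mass /= translateE preimage_setU setIUl -!translateE.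
rewrite measureU//=.
- by apply: measurableI => //; exact: measurable_translate.
- by apply: measurableI => //; exact: measurable_translate.
- rewrite setIACA setIid !translateE -preimage_setI.
  by rewrite ps preimage_set0 set0I.
Qed.

Lemma mass_segments_fin s t : separated s -> mass s t \is a fin_num.
Proof.
elim: s => [|p s ih] ss.
  by rewrite /mass /= translateE preimage_set0 set0I measure0.
rewrite mass_segments_cons// fin_numD; case: ss => pp _ /ih ->.
by rewrite andbT window_fin// ltW.
Qed.

Lemma mass_segments_le s t t' : separated s ->
  (forall p, p \in s -> forall x, T x -> T (x + (p.2 - p.1))) -> t <= t' ->
  (mass s t <= mass s t')%E.
Proof.
move=> + + tt'; elim: s => [|p s ih] ss Tl.
  by rewrite /mass /= !translateE !preimage_set0.
rewrite !mass_segments_cons//; case: ss => pp _ ss.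
apply: leeD; last first.
  by apply: ih => // q qs; apply: Tl; rewrite in_cons qs orbT.
rewrite -[p.2](subrKC p.1); apply: window_le => //; last by rewrite subr_ge0 ltW.
by apply: Tl; rewrite mem_head.
Qed.

End sliding_segments.

Theorem theorem2p4 (R : realType) (E : set R)
    (hE : finite_union_of_intervals E) (hE0 : E !=set0) :
  exists T : set R, lebesgue_measurable T /\
    forall t t' : R, t <> t' ->
      completed_lebesgue_measure (translate E t `&` T)
        <> completed_lebesgue_measure (translate E t' `&` T).
Proof.
have [[|p s] sepE Es] := finite_union_separated hE.
  by move: hE0 => [x]; rewrite -Es.
pose L := [seq q.2 - q.1 | q <- p :: s].
have L0 k : k \in L -> 0 < k.
  move=> /mapP[q qs ->]; rewrite subr_gt0.
  by elim: (p :: s) sepE qs => //= a r ih [? _ /ih rr]; rewrite in_cons => /predU1P[->|/rr].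
have [T [Y [mT TL [mY YT YlT] Ypos]]] := increasing_test_set L0 (mem_head _ _).
exists T; split; first exact: borel_lebesgue_measurable.
suff lt t t' : t < t' -> (lebesgue_measure (translate E t `&` T)
    < lebesgue_measure (translate E t' `&` T))%E.
  move=> t t'; rewrite !completed_lebesgue_measureE => /eqP.
  by rewrite neq_lt => /orP[] /lt + eqm; rewrite eqm ltxx.
move=> tt'; rewrite -Es !mass_segments_cons//.
have [pp _ ss] := sepE.
apply: lte_leD.
- exact: mass_segments_fin.
(* The window of the first segment is the one whose mass grows strictly. *)
- rewrite -[p.2](subrKC p.1).
  apply: (window_lt mT _ mY YT YlT Ypos) => //; last by rewrite subr_ge0 ltW.
  by apply: TL; rewrite mem_head.
- apply: mass_segments_le => //; last exact: ltW.
  move=> q qs; apply: TL; apply: (map_f (fun q => q.2 - q.1)).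
  by rewrite in_cons qs orbT.
Qed.
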